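(* Let $C$ be an algebraically closed field of characteristic zero with the zero derivation, and let $h$ be a nonzero rational function in one variable over $C$. Then the rational autonomous differential equation $y'=h(y)$ over $C$ is not of general type if and only if it has at most one $C$-algebraically independent solution in any given differential field extension of $C$ having $C$ as its field of constants.
   Context: A solution of $y'=h(y)$ is an element $u$ of a differential field extension of $C$ having $C$ as its field of constants such that $u'=h(u)$; it is nonalgebraic if it is not algebraic over $C$ (i.e. not in $C$). ''At most one $C$-algebraically independent solution in $L$'' means that any two distinct solutions in $L$ are algebraically dependent over $C$. The function field of the equation is $C(y)$, the field of rational functions in $y$ over $C$ with the derivation that is zero on $C$ and satisfies $y'=h(y)$. The equation $y'=h(y)$ over $C$ is of: - algebraic type if all of its solutions are algebraic over $C$, or equivalently, $C(y)$ has a constant not in $C$; - Riccati type if it has a nonalgebraic solution and there is an element $t\in C(y)$ such that $C(y)$ is a finite algebraic extension of $C(t)$ and $t'=a_2t^2+a_1t+a_0$ with $a_0,a_1,a_2\in C$ not all zero; - Weierstrass type if it has a nonalgebraic solution and there is an element $t\in C(y)$ such that $C(y)$ is a finite algebraic extension of $C(t,t')$ and $(t')^2=\alpha^2(4t^3-g_2t-g_3)$ with $g_2,g_3,\alpha\in C$ and $27g_3^2-g_2^3\neq0$; - general type if it is not of algebraic, Riccati or Weierstrass type. *)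

(* Defs.v *)
From mathcomp Require Import all_boot all_order all_algebra.
From mathcomp Require Import ring.

Set Implicit Arguments.
Unset Strict Implicit.
Unset Printing Implicit Defensive.

Import GRing.Theory.
Local Open Scope ring_scope.

Notation "x %:F" := (tofrac x) : ring_scope.

(* Differential field extensions of C, where C carries the zero derivation. *)
Record diffExt (C : fieldType) := DiffExt {
  dfield :> fieldType;
  diota : {rmorphism C -> dfield};
  dder : dfield -> dfield;
  dderD : forall x y, dder (x + y) = dder x + dder y;
  dderM : forall x y, dder (x * y) = dder x * y + x * dder y;
  dderC : forall c, dder (diota c) = 0
}.
Arguments diota {C d}.
Arguments dder {C d}.

Definition constants_are_base (C : fieldType) (L : diffExt C) : Prop :=
  forall x : L, dder x = 0 -> exists c : C, x = diota c.

(* u' = h(u). The value h(u) is defined when h has some representation p / q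
   with q(u) != 0; p and q are not required to be coprime, so a removable
   common zero of a particular representation does not matter. *)
Definition solution (C : fieldType) (h : {fraction {poly C}})
    (L : diffExt C) (u : L) : Prop :=
  exists p q : {poly C},
    [/\ h = p%:F / q%:F,
        (map_poly diota q).[u] != 0 &
        dder u = (map_poly diota p).[u] / (map_poly diota q).[u]].

Definition alg_dependent (C : fieldType) (L : diffExt C) (u v : L) : Prop :=
  exists2 P : {poly {poly C}},
    P != 0 & (map_poly (map_poly diota) P).[v%:P].[u] = 0.

Definition at_most_one_independent_solution (C : fieldType)
    (h : {fraction {poly C}}) (L : diffExt C) : Prop :=
  forall u v : L, solution h u -> solution h v -> u <> v -> alg_dependent u v.

Section FunctionField.
Variables (C : fieldType) (h : {fraction {poly C}}).
Local Notation K := {fraction {poly C}}.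

(* (p / q)' = ((dp/dy) q - p (dq/dy)) / q^2 * h, computed on the
   representative chosen by the quotient; ratder_frac shows that the choice
   does not matter. *)
Definition ratder (f : K) : K :=
  let p := \n_(repr f) in let q := \d_(repr f) in
  (p^`() * q - p * q^`())%:F / (q ^+ 2)%:F * h.

Definition ratiota : {rmorphism C -> K} := (@tofrac {poly C}) \o polyC.

Lemma frac_repr (f : K) :
  \d_(repr f) != 0 /\ f = (\n_(repr f))%:F / (\d_(repr f))%:F.
Proof.
have d0 : \d_(repr f) != 0 by exact: denom_ratioP.
split=> //; have dF0 : (\d_(repr f))%:F != 0 :> K by rewrite tofrac_eq0.
apply: (mulIf dF0); rewrite divfK // -[X in X * _](reprK f) /=.
unlock tofrac; rewrite -[LHS]FracField.pi_mul; apply/eqmodP.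
by rewrite /= FracField.equivfE /FracField.mulf !numden_Ratio ?mulf_neq0 ?oner_neq0 //= !mulr1 mulrC.
Qed.

Lemma ratder_frac (p q : {poly C}) : q != 0 ->
  ratder (p%:F / q%:F) = (p^`() * q - p * q^`())%:F / (q ^+ 2)%:F * h.
Proof.
move=> q0; rewrite /ratder.
have [] := frac_repr (p%:F / q%:F).
move: (\n_(repr _)) (\d_(repr _)) => a b b0 /eqP.
rewrite eqr_div ?tofrac_eq0 // -!tofracM tofrac_eq => /eqP/esym E.
have E' := congr1 (@deriv C) E; rewrite !derivM in E'.
congr (_ * h); apply/eqP; rewrite eqr_div ?tofrac_eq0 ?expf_neq0 //.
rewrite -!tofracM tofrac_eq; apply/eqP.
have -> : (a^`() * b - a * b^`()) * q ^+ 2 =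
   b * q * (a^`() * q + a * q^`()) - (a * q) * (b * q)^`().
  by rewrite derivM; ring.
rewrite E' E derivM; ring.
Qed.

Lemma fracD (a b c d : {poly C}) : b != 0 -> d != 0 ->
  a%:F / b%:F + c%:F / d%:F = (a * d + c * b)%:F / (b * d)%:F :> K.
Proof.
by move=> b0 d0; rewrite addf_div ?tofrac_eq0 // (tofracM b d) tofracD (tofracM a) (tofracM c).
Qed.

Lemma fracM (a b c d : {poly C}) :
  (a%:F / b%:F) * (c%:F / d%:F) = (a * c)%:F / (b * d)%:F :> K.
Proof. by rewrite mulf_div (tofracM b d) (tofracM a c). Qed.

Lemma frac_eq (a b c d : {poly C}) : b != 0 -> d != 0 -> a * d = c * b ->
  a%:F / b%:F = c%:F / d%:F :> K.
Proof.
move=> b0 d0 E; apply/eqP; rewrite eqr_div ?tofrac_eq0 //.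
by rewrite -(tofracM a d) -(tofracM c b) E.
Qed.

Lemma ratderD (f g : K) : ratder (f + g) = ratder f + ratder g.
Proof.
have [b0 fE] := frac_repr f; have [d0 gE] := frac_repr g.
rewrite {}fE {}gE; move: b0 d0.
move: (\n_(repr f)) (\d_(repr f)) (\n_(repr g)) (\d_(repr g)) => a b c d b0 d0.
rewrite fracD // !ratder_frac ?mulf_neq0 // -mulrDl; congr (_ * h).
rewrite fracD ?expf_neq0 //.
apply: frac_eq; rewrite ?mulf_neq0 ?expf_neq0 ?mulf_neq0 //.
by rewrite derivD !derivM; ring.
Qed.

Lemma ratderM (f g : K) : ratder (f * g) = ratder f * g + f * ratder g.
Proof.
have [b0 fE] := frac_repr f; have [d0 gE] := frac_repr g.
rewrite fE gE {fE gE}; move: b0 d0.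
move: (\n_(repr f)) (\d_(repr f)) (\n_(repr g)) (\d_(repr g)) => a b c d b0 d0.
rewrite fracM !ratder_frac ?mulf_neq0 //.
rewrite [_ * h * _]mulrAC [_ / _ * (_ * h)]mulrA -mulrDl; congr (_ * h).
rewrite !fracM fracD ?mulf_neq0 ?expf_neq0 //.
apply: frac_eq; rewrite ?mulf_neq0 ?expf_neq0 ?mulf_neq0 //.
by rewrite !derivM; ring.
Qed.

Lemma ratderC (c : C) : ratder (ratiota c) = 0.
Proof.
have -> : ratiota c = c%:P%:F / 1%:F by rewrite tofrac1 divr1.
by rewrite ratder_frac ?oner_neq0 // derivC derivE mul0r mulr0 subrr tofrac0 !mul0r.
Qed.

Lemma ratder_y : ratder ('X%:F) = h.
Proof.
have -> : 'X%:F = 'X%:F / 1%:F :> K by rewrite tofrac1 divr1.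
rewrite ratder_frac ?oner_neq0 // derivX mul1r derivE mulr0 subr0 expr1n.
by rewrite tofrac1 divr1 mul1r.
Qed.

Definition funfield : diffExt C := DiffExt ratderD ratderM ratderC.

End FunctionField.

Section Subfields.
Variables (C E : fieldType) (iota : {rmorphism C -> E}).

Definition is_subfield (S : E -> Prop) : Prop :=
  [/\ S 1, forall x y, S x -> S y -> S (x - y)
         & forall x y, S x -> S y -> S (x / y)].

Definition adjoin (s : seq E) (x : E) : Prop :=
  forall S : E -> Prop, is_subfield S -> (forall c, S (iota c)) ->
    (forall y, y \in s -> S y) -> S x.

(* E has finite degree over its subfield S, hence is algebraic over S.  This
   is stated on predicates because the subfields and towers used here are
   infinite-dimensional over C, out of reach of fieldExtType. *)
Definition finite_over (S : E -> Prop) : Prop :=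
  exists s : seq E, forall x : E, exists2 a : 'I_(size s) -> E,
    (forall i, S (a i)) & x = \sum_i a i * s`_i.

End Subfields.

Section Types.
Variables (C : fieldType) (h : {fraction {poly C}}).

Definition algebraic_type : Prop :=
  forall L : diffExt C, constants_are_base L ->
  forall u : L, solution h u -> algebraicOver diota u.

Definition has_nonalgebraic_solution : Prop :=
  exists (L : diffExt C) (u : L),
    [/\ constants_are_base L, solution h u & ~ algebraicOver diota u].

Definition riccati_type : Prop :=
  has_nonalgebraic_solution /\
  exists (t : funfield h) (a2 a1 a0 : C),
    [/\ finite_over (adjoin diota [:: t]),
        dder t = diota a2 * t ^+ 2 + diota a1 * t + diota a0 &
        ~ [/\ a2 = 0, a1 = 0 & a0 = 0]].

Definition weierstrass_type : Prop :=
  has_nonalgebraic_solution /\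
  exists (t : funfield h) (g2 g3 alpha : C),
    [/\ finite_over (adjoin diota [:: t; dder t]),
        dder t ^+ 2 = diota alpha ^+ 2 *
          (4%:R * t ^+ 3 - diota g2 * t - diota g3) &
        27%:R * g3 ^+ 2 - g2 ^+ 3 != 0].

Definition general_type : Prop :=
  ~ algebraic_type /\ ~ riccati_type /\ ~ weierstrass_type.

End Types.

(* Main.v *)
(** Since [h <> 0], the constants of C(y) are C, so the algebraic type never
    occurs and the question is about the Riccati and Weierstrass types.

    In those types the image of [t] under two nonalgebraic solutions [u], [v]
    gives solutions of the same Riccati or Weierstrass equation, and such a pair
    has an explicit first integral: a difference or a quotient after
    linearizing the Riccati equation, the abscissa of the difference of two
    points on the elliptic curve in the Weierstrass case.  Its value lies in C,
    which makes [t(v)] algebraic over C(u), and hence [v] as well.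

    Conversely, let C(u, v) carry the derivation with [u' = h(u)], [v' = h(v)].
    If [1/h] is a polynomial it has an antiderivative [t], and [t' = 1] is of
    Riccati type.  Otherwise [h] has a zero [a], of order [n + 1] say.  Expand a
    constant [F] outside C at [v = a] as [w^k (G_0 + G_1 w + ...)], with
    [w = v - a], [G_i] in C(u) and [k <> 0] after subtracting an element of C.
    Then [F' = 0] gives [G_i' = 0] for [i < n] and [G_n' = c G_0] for some
    nonzero [c] in C, so that [G_n] is a Riccati function of [u].  Hence for the
    general type all constants of C(u, v) lie in C. *)

Require Import Defs.
From HB Require Import structures.
From mathcomp Require Import all_boot all_order all_algebra.
From mathcomp Require Import fieldext ring.
From Stdlib Require Import Classical.
Import GRing.Theory.
Local Open Scope ring_scope.

Set Implicit Arguments.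
Unset Strict Implicit.
Unset Printing Implicit Defensive.

(** * Fraction fields *)

Section FieldIdentities.
Variable F : fieldType.
Implicit Types a b c d : F.

Lemma subf_frac a b c d : b != 0 -> d != 0 ->
  a / b - c / d = (a * d - c * b) / (b * d).
Proof. by move=> b0 d0; field; rewrite b0 d0. Qed.

(** Primed letters stand for derivatives, and the second equation is the first one differentiated;
    so the quotient rule does not depend on the chosen representative. *)
Lemma quotient_rule_eq a b c d a' b' c' d' : b != 0 -> d != 0 ->
  a * d = c * b -> a' * d + a * d' = c' * b + c * b' ->
  (a' * b - a * b') / b ^+ 2 = (c' * d - c * d') / d ^+ 2.
Proof.
move=> b0 d0 E1 E2; apply/eqP; rewrite eqr_div ?expf_neq0 //; apply/eqP.
have -> : (c' * d - c * d') * b ^+ 2 =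
   b * d * (c' * b + c * b') - (c * b) * (b' * d + b * d') by ring.
by rewrite -E2 -E1; ring.
Qed.

Lemma quotient_ruleD a b c d a' b' c' d' : b != 0 -> d != 0 ->
  ((a' * d + a * d' + (c' * b + c * b')) * (b * d)
     - (a * d + c * b) * (b' * d + b * d')) / (b * d) ^+ 2 =
  (a' * b - a * b') / b ^+ 2 + (c' * d - c * d') / d ^+ 2.
Proof. by move=> b0 d0; field; rewrite b0 d0. Qed.

Lemma quotient_ruleM a b c d a' b' c' d' : b != 0 -> d != 0 ->
  ((a' * c + a * c') * (b * d) - (a * c) * (b' * d + b * d')) / (b * d) ^+ 2 =
  (a' * b - a * b') / b ^+ 2 * (c / d) + (a / b) * ((c' * d - c * d') / d ^+ 2).
Proof. by move=> b0 d0; field; rewrite b0 d0. Qed.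

End FieldIdentities.

Section FractionField.
Variable R : idomainType.
Implicit Types (f g : {fraction R}) (a b c d : R).

Lemma fraction_repr f : \d_(repr f) != 0 /\ f = (\n_(repr f))%:F / (\d_(repr f))%:F.
Proof.
have d0 : \d_(repr f) != 0 by exact: denom_ratioP.
split=> //; have dF0 : (\d_(repr f))%:F != 0 :> {fraction R} by rewrite tofrac_eq0.
apply: (mulIf dF0); rewrite divfK // -[X in X * _](reprK f) /=.
unlock tofrac; rewrite -[LHS]FracField.pi_mul; apply/eqmodP.
rewrite /= FracField.equivfE /FracField.mulf.
by rewrite !numden_Ratio ?mulf_neq0 ?oner_neq0 //= !mulr1 mulrC.
Qed.

Lemma fractionP f : exists a b, b != 0 /\ f = a%:F / b%:F.
Proof. by exists (\n_(repr f)), (\d_(repr f)); exact: fraction_repr. Qed.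

Lemma eq_fraction a b c d : b != 0 -> d != 0 ->
  a%:F / b%:F = c%:F / d%:F -> a * d = c * b.
Proof.
move=> b0 d0 /eqP; rewrite eqr_div ?tofrac_eq0 // -!tofracM tofrac_eq.
by move/eqP.
Qed.

Section FracMap.
Variables (E : fieldType) (g : {rmorphism R -> E}).
Hypothesis g_inj : forall x, x != 0 -> g x != 0.

(** The proof of nonvanishing is an argument, so that the morphism structures below can be attached
    to [fracmap g_inj]. *)
Definition fracmap of (forall x, x != 0 -> g x != 0) := fun f : {fraction R} =>
  g \n_(repr f) / g \d_(repr f).

Lemma fracmapE a b : b != 0 -> fracmap g_inj (a%:F / b%:F) = g a / g b.
Proof.
move=> b0; rewrite /fracmap; have [] := fraction_repr (a%:F / b%:F).
move: (\n_(repr _)) (\d_(repr _)) => c d d0 /eq_fraction E1.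
by apply/eqP; rewrite eqr_div ?g_inj // -!rmorphM E1.
Qed.

Lemma fracmap_zmod : zmod_morphism (fracmap g_inj).
Proof.
move=> x y; have [a [b [b0 ->]]] := fractionP x; have [c [d [d0 ->]]] := fractionP y.
rewrite subf_frac ?tofrac_eq0 // -!tofracM -tofracB.
by rewrite !fracmapE ?mulf_neq0 // rmorphB !rmorphM subf_frac ?g_inj.
Qed.

Lemma fracmap_monoid : monoid_morphism (fracmap g_inj).
Proof.
split=> [|x y].
  by rewrite -[1 in LHS](divr1 1) -tofrac1 fracmapE ?oner_neq0 // divff // rmorph1 oner_neq0.
have [a [b [b0 ->]]] := fractionP x; have [c [d [d0 ->]]] := fractionP y.
by rewrite mulf_div -!tofracM !fracmapE ?mulf_neq0 // !rmorphM mulf_div.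
Qed.

HB.instance Definition _ := GRing.isZmodMorphism.Build _ _ (fracmap g_inj) fracmap_zmod.
HB.instance Definition _ := GRing.isMonoidMorphism.Build _ _ (fracmap g_inj) fracmap_monoid.

Lemma fracmap_tofrac a : fracmap g_inj a%:F = g a.
Proof. by rewrite -[a%:F]divr1 -tofrac1 fracmapE ?oner_neq0 // rmorph1 divr1. Qed.

End FracMap.

Section FracDer.
Variable delta : R -> {fraction R}.
Hypothesis deltaD : forall x y, delta (x + y) = delta x + delta y.
Hypothesis deltaM : forall x y, delta (x * y) = delta x * y%:F + x%:F * delta y.

(** [delta] takes values in the fraction field, since the generator of K(w) will have a rational
    function as its derivative. *)
Definition fracder f : {fraction R} :=
  let p := \n_(repr f) in let q := \d_(repr f) in
  (delta p * q%:F - p%:F * delta q) / q%:F ^+ 2.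

Lemma fracder_frac a b : b != 0 ->
  fracder (a%:F / b%:F) = (delta a * b%:F - a%:F * delta b) / b%:F ^+ 2.
Proof.
move=> b0; rewrite /fracder; have [] := fraction_repr (a%:F / b%:F).
move: (\n_(repr _)) (\d_(repr _)) => c d d0 /(eq_fraction b0 d0) E1.
have := congr1 delta E1; rewrite !deltaM => E2.
have := congr1 (@tofrac R) E1; rewrite !tofracM => E3.
by apply/esym/quotient_rule_eq; rewrite ?tofrac_eq0.
Qed.

Lemma fracderD f g : fracder (f + g) = fracder f + fracder g.
Proof.
have [a [b [b0 ->]]] := fractionP f; have [c [d [d0 ->]]] := fractionP g.
rewrite addf_div ?tofrac_eq0 // -!tofracM -tofracD !fracder_frac ?mulf_neq0 //.
by rewrite deltaD !deltaM tofracD !tofracM quotient_ruleD ?tofrac_eq0.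
Qed.

Lemma fracderM f g : fracder (f * g) = fracder f * g + f * fracder g.
Proof.
have [a [b [b0 ->]]] := fractionP f; have [c [d [d0 ->]]] := fractionP g.
rewrite mulf_div -!tofracM !fracder_frac ?mulf_neq0 //.
by rewrite !deltaM !tofracM quotient_ruleM ?tofrac_eq0.
Qed.

Lemma fracder_tofrac a : fracder a%:F = delta a.
Proof.
have d1 : delta 1 = 0.
  have := deltaM 1 1; rewrite mulr1 tofrac1 mulr1 mul1r => /eqP.
  by rewrite -subr_eq0 opprD addNKr oppr_eq0 => /eqP.
rewrite -[a%:F]divr1 -tofrac1 fracder_frac ?oner_neq0 // d1 tofrac1.
by rewrite mulr0 subr0 expr1n divr1 mulr1.
Qed.

End FracDer.
End FractionField.

(** * Evaluation of rational functions at a solution *)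

Section Derivation.
Variables (C : fieldType) (L : diffExt C).
Implicit Types (x y u : L) (c : C).

Lemma dder0 : dder (0 : L) = 0.
Proof. by rewrite -[X in dder X](rmorph0 (@diota C L)) dderC. Qed.

Lemma dderN x : dder (- x) = - dder x.
Proof. by apply/eqP; rewrite -addr_eq0 -dderD addNr dder0. Qed.

Lemma dderB x y : dder (x - y) = dder x - dder y.
Proof. by rewrite dderD dderN. Qed.

Lemma dderZ c x : dder (diota c * x) = diota c * dder x.
Proof. by rewrite dderM dderC mul0r add0r. Qed.

Lemma dder_div x y : y != 0 -> dder (x / y) = (dder x * y - x * dder y) / y ^+ 2.
Proof.
move=> y0; have := dderM (x / y) y; rewrite divfK // => ->.
by field.
Qed.

Lemma dder_horner (p : {poly C}) u :
  dder (map_poly diota p).[u] = (map_poly diota p^`()).[u] * dder u.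
Proof.
elim/poly_ind: p => [|p c IHp]; first by rewrite derivE !rmorph0 !horner0 dder0 mul0r.
rewrite derivMXaddC !rmorphD !rmorphM /= map_polyX map_polyC !hornerE /=.
by rewrite dderD dderM IHp dderC; ring.
Qed.

End Derivation.

Section Evaluation.
Variables (C : fieldType) (L : diffExt C).

Definition nonconstant (t : L) := forall c, t <> diota c.

Definition polyeval (u : L) : {rmorphism {poly C} -> L} :=
  horner_eval u \o map_poly diota.

Definition transcendental u := forall p, p != 0 -> polyeval u p != 0.

Lemma nonalgebraic_transcendental (u : L) :
  ~ algebraicOver diota u -> transcendental u.
Proof. by move=> nalg p p0; apply/negP => pu0; apply: nalg; exists p. Qed.

Variables (u : L) (utr : transcendental u).

Definition fraceval : {rmorphism {fraction {poly C}} -> L} := fracmap utr.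

Lemma fracevalE (p q : {poly C}) : q != 0 ->
  fraceval (p%:F / q%:F) = (map_poly diota p).[u] / (map_poly diota q).[u].
Proof. exact: fracmapE. Qed.

Variable h : {fraction {poly C}}.

Lemma fraceval_diota (c : C) : fraceval (diota c : funfield h) = diota c.
Proof. by rewrite /= fracmap_tofrac /= map_polyC /horner_eval hornerC. Qed.

Lemma fraceval_dder (f : funfield h) :
  solution h u -> dder (fraceval f) = fraceval (dder f).
Proof.
case=> p [q [hE q0 du]].
have [a [b [b0 ->]]] := fractionP f.
have qn0 : q != 0 by apply: contraNneq q0 => ->; rewrite rmorph0 horner0.
have bu0 := utr b0; rewrite /= /ratder.
rewrite /= -/(ratder h _) ratder_frac //.
rewrite hE.
rewrite fracevalE // dder_div // !dder_horner du rmorphM /=.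
rewrite !fracmapE ?expf_neq0 //= /horner_eval.
rewrite !rmorphB !rmorphXn !rmorphM !hornerE /=.
by field; rewrite q0; apply: bu0.
Qed.

End Evaluation.

Lemma clear_denominators (R : idomainType) (P : {poly {fraction R}}) :
  exists (c : R) (Q : {poly R}), c != 0 /\ c%:F *: P = map_poly (@tofrac R) Q.
Proof.
elim/poly_ind: P => [|P f [c [Q [c0 PQ]]]].
  by exists 1, 0; rewrite oner_neq0 scaler0 rmorph0.
have [a [b [b0 ->]]] := fractionP f.
exists (c * b), (b *: Q * 'X + (c * a)%:P); split; first by rewrite mulf_neq0.
apply/polyP => i; move/polyP/(_ i.-1): PQ; rewrite coefZ !coef_map coefZ /=.
rewrite !coefD !coefMX !coefC !coefZ.
case: i => [_|i /= PQ] /=.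
  by rewrite !add0r !tofracM -mulrA [b%:F * _]mulrC divfK ?tofrac_eq0.
by rewrite !addr0 !tofracM -PQ mulrCA mulrA.
Qed.

(** In [alg_dependent] the outer variable stands for [v] and the inner one for [u]; evaluating the
    inner one first leaves a one-variable polynomial over [L]. *)
Lemma horner2_polyeval (C : fieldType) (L : diffExt C) (u v : L)
    (P : {poly {poly C}}) :
  (map_poly (map_poly diota) P).[v%:P].[u] = (map_poly (polyeval u) P).[v].
Proof.
rewrite /polyeval /= (map_poly_comp (horner_eval u)).
by rewrite -[X in _ = _.[X]](hornerC v u) -[_.[u] in RHS]/(horner_eval u _) horner_map.
Qed.

Lemma alg_dependent_algebraic (C : fieldType) (L : diffExt C) (u v : L)
    (utr : transcendental u) :
  algebraicOver (fraceval utr) v -> alg_dependent u v.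
Proof.
case=> P P0; have [c [Q [c0 PQ]]] := clear_denominators P => /rootP Pv.
have Q0 : Q != 0.
  apply: contraNneq P0 => Q0; move/eqP: PQ.
  by rewrite Q0 rmorph0 scaler_eq0 tofrac_eq0 (negPf c0).
exists Q => //.
rewrite horner2_polyeval.
have -> : map_poly (polyeval u) Q = map_poly (fraceval utr) (map_poly (@tofrac _) Q).
  rewrite -map_poly_comp; apply: eq_map_poly => p /=.
  by rewrite fracmap_tofrac.
by rewrite -PQ map_polyZ hornerZ Pv mulr0.
Qed.

(** With t = a / b, [v] is a root of a - t(v) b, whose coefficients are algebraic as soon as t(v)
    is. The base will be C(u) in one use and C(t) in another. *)
Lemma algebraic_fraceval (C F : fieldType) (L : diffExt C)
    (h : {fraction {poly C}}) (phi : {rmorphism F -> L})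
    (iota : C -> F) (phiC : forall c, phi (iota c) = diota c)
    (v : L) (vtr : transcendental v) (t : funfield h) :
  nonconstant t -> algebraicOver phi (fraceval vtr t) -> algebraicOver phi v.
Proof.
have [a [b [b0 ->]]] := fractionP t => tnc /integral_algebraic talg.
set t2 := fraceval _ _ in talg.
have iC c : integralOver phi (diota c).
  by rewrite -phiC; apply/integral_algebraic/algebraic_id.
apply/integral_algebraic.
apply: (@integral_root _ _ _ (map_poly diota a - t2 *: map_poly diota b)).
(* If the polynomial vanished, its coefficient at the degree of b would make t(v), hence t, an
   element of C. *)
- apply/eqP => /polyP E.
  have lb0 : lead_coef b != 0 by rewrite lead_coef_eq0.
  pose c := a`_(size b).-1 / lead_coef b.
  apply: (tnc c); apply: (fmorph_inj (fraceval vtr)).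
  rewrite fraceval_diota -/t2 rmorphM fmorphV /=.
  have := E (size b).-1; rewrite coefB coefZ !coef_map coef0 /= => /eqP.
  rewrite subr_eq0 => /eqP ->; rewrite -/(lead_coef b) mulfK //.
  by rewrite fmorph_eq0.
- rewrite rootE !hornerE /t2 fracevalE // divfK ?subrr //.
  exact: (vtr b b0).
- apply/integral_poly => i; rewrite coefB coefZ !coef_map /=.
  by apply: integral_sub=> //; exact: integral_mul.
Qed.

(** * First integrals *)

Section FirstIntegrals.
Variables (C : fieldType) (L0 L : diffExt C).
Hypothesis Lconst : constants_are_base L.
Variables phi1 phi2 : {rmorphism L0 -> L}.
Hypothesis phi1D : forall x, dder (phi1 x) = phi1 (dder x).
Hypothesis phi2D : forall x, dder (phi2 x) = phi2 (dder x).
Hypothesis phi1C : forall c, phi1 (diota c) = diota c.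
Hypothesis phi2C : forall c, phi2 (diota c) = diota c.
Implicit Type t : L0.

Lemma algebraic_const c : algebraicOver phi1 (diota c).
Proof. by rewrite -phi1C; exact: algebraic_id. Qed.

Lemma image_nonconstant (phi : {rmorphism L0 -> L}) t :
  (forall c, phi (diota c) = diota c) -> nonconstant t -> nonconstant (phi t).
Proof. by move=> phiC tnc c tc; apply: (tnc c); apply: (fmorph_inj phi); rewrite tc phiC. Qed.

(** If b = 0, two solutions differ by a constant; otherwise t + c / b satisfies a homogeneous
    equation, and two solutions of that have a constant quotient. In the application [phi1] and
    [phi2] are evaluation at [u] and at [v]. *)
Lemma linear_algebraic t b c : nonconstant t ->
  dder t = diota b * t + diota c -> algebraicOver phi1 (phi2 t).
Proof.
move=> tnc tD.
have D1 : dder (phi1 t) = diota b * phi1 t + diota c.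
  by rewrite phi1D tD rmorphD rmorphM !phi1C.
have D2 : dder (phi2 t) = diota b * phi2 t + diota c.
  by rewrite phi2D tD rmorphD rmorphM !phi2C.
have alg1 := algebraic_id phi1 t.
have [b0|b0] := eqVneq b 0.
  have [e Ee] : exists e : C, phi2 t - phi1 t = diota e.
    by apply: Lconst; rewrite dderB D1 D2 b0 rmorph0 !mul0r subrr.
  rewrite -(subrK (phi1 t) (phi2 t)) Ee; apply: algebraic_add => //.
  exact: algebraic_const.
pose d := c / b; have bL0 : diota b != 0 :> L by rewrite fmorph_eq0.
have Ed : diota b * diota d = diota c :> L by rewrite -rmorphM /d mulrC divfK.
have n0 : phi1 t + diota d != 0.
  rewrite addr_eq0 -rmorphN; apply/eqP; exact: image_nonconstant.
have [e Ee] : exists e : C, (phi2 t + diota d) / (phi1 t + diota d) = diota e.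
  apply: Lconst; rewrite dder_div // !dderD !dderC !addr0 D1 D2 -Ed.
  by rewrite [X in X / _](_ : _ = 0) ?mul0r //; ring.
have -> : phi2 t = diota e * (phi1 t + diota d) - diota d.
  by rewrite -Ee divfK // addrK.
have algC := algebraic_const.
by apply: algebraic_sub => //; apply: algebraic_mul => //; apply: algebraic_add.
Qed.

Lemma weierstrass_algebraic t g2 g3 alpha :
  2%:R != 0 :> C -> nonconstant t ->
  dder t != 0 ->
  dder t ^+ 2 = diota alpha ^+ 2 * (4%:R * t ^+ 3 - diota g2 * t - diota g3) ->
  algebraicOver phi1 (phi2 t).
Proof.
move=> two0 tnc tD0 tD.
have two0L : 2%:R != 0 :> L by rewrite -(rmorph_nat (@diota C L)) fmorph_eq0.
have two00 : 2%:R != 0 :> L0 by rewrite -(rmorph_nat (@diota C L0)) fmorph_eq0.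
have al0 : alpha != 0.
  by apply: contra_neq tD0 => a0; apply/eqP; rewrite -sqrf_eq0 tD a0 rmorph0 expr0n mul0r.
pose a : L := diota alpha; have a0 : a != 0 by rewrite fmorph_eq0.
(* Differentiating [tD] and cancelling the nonzero t' expresses t'' through t alone. *)
have tDD : 2%:R * dder (dder t) = diota alpha ^+ 2 * (12%:R * t ^+ 2 - diota g2).
  have := congr1 dder tD; rewrite -rmorphXn dderZ !dderB !dderC dderZ.
  have -> : 4%:R = diota (4%:R) :> L0 by rewrite rmorph_nat.
  rewrite dderZ !exprS !expr0 !mulr1 !dderM rmorph_nat => E.
  by apply: (mulfI tD0); apply: etrans (etrans E _); ring.
have transfer (phi : {rmorphism L0 -> L}) : (forall x, dder (phi x) = phi (dder x)) ->
    (forall c, phi (diota c) = diota c) ->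
  [/\ dder (phi t) = phi (dder t),
      phi (dder t) ^+ 2 = a ^+ 2 * (4%:R * phi t ^+ 3 - diota g2 * phi t - diota g3)
    & 2%:R * dder (phi (dder t)) = a ^+ 2 * (12%:R * phi t ^+ 2 - diota g2)].
  move=> phiD phiC; split=> //.
    rewrite -rmorphXn tD !(rmorphM, rmorphB, rmorphXn) /= !phiC.
    by rewrite ?rmorph_nat.
  rewrite phiD -(rmorph_nat phi 2) -rmorphM tDD !(rmorphM, rmorphB, rmorphXn) /= !phiC.
  by rewrite ?rmorph_nat.
have [D1 S1 DD1] := transfer _ phi1D phi1C.
have [D2 S2 DD2] := transfer _ phi2D phi2C.
have tnc1 := image_nonconstant phi1C tnc.
move: D1 S1 DD1 D2 S2 DD2.
(* The slope below needs distinct abscissas; if they agree, [phi2 t] already lies in the image of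
   [phi1]. *)
have [E12|n12] := eqVneq (phi1 t) (phi2 t).
  by move=> *; rewrite -E12; exact: algebraic_id.
set s1 := phi1 (dder t); set s2 := phi2 (dder t).
pose t1 := phi1 t; pose t2 := phi2 t; rewrite -/t1 -/t2 => D1 S1 DD1 D2 S2 DD2.
have T0 : t1 - t2 != 0 by rewrite subr_eq0.
(* y is the slope of the line through (t1, s1) and (t2, - s2); the expression
   below is, up to a factor, the abscissa of the difference of the points. *)
pose y := (s1 + s2) / (t1 - t2).
have yD : dder y = 2%:R * a ^+ 2 * (t1 - t2).
  rewrite dder_div // dderD dderB D1 D2.
  apply: (mulfI two0L); apply: (mulIf (expf_neq0 2 T0)).
  rewrite -[LHS]mulrA divfK ?expf_neq0 //.
  have -> : 2%:R * ((dder s1 + dder s2) * (t1 - t2) - (s1 + s2) * (s1 - s2)) =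
    (2%:R * dder s1 + 2%:R * dder s2) * (t1 - t2) - 2%:R * (s1 ^+ 2 - s2 ^+ 2) by ring.
  by rewrite DD1 DD2 S1 S2; ring.
have yT : y * (t1 - t2) = s1 + s2 by rewrite divfK.
(* The derivative of y^2 is 4 a^2 (t1 - t2) y = 4 a^2 (s1 + s2), which is also that of 4 a^2 (t1 +
   t2). *)
have [c Ec] : exists c : C, y ^+ 2 - 4%:R * a ^+ 2 * (t1 + t2) = diota c.
  apply: Lconst; have -> : 4%:R * a ^+ 2 = diota (4%:R * alpha ^+ 2).
    by rewrite rmorphM rmorphXn rmorph_nat.
  rewrite dderB dderZ expr2 dderM dderD D1 D2 -yT yD rmorphM rmorphXn rmorph_nat -/a; ring.
have rel : (s1 + s2) ^+ 2 = (diota c + 4%:R * a ^+ 2 * (t1 + t2)) * (t1 - t2) ^+ 2.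
  by rewrite -Ec subrK -exprMn yT.
(* Squaring k t2^2 + l t2 + m = 2 s1 s2, which is [rel] expanded, eliminates s2
   and makes t2 a root of M. *)
pose A : L0 := diota alpha; pose c' : L0 := diota c.
pose G2 : L0 := diota g2; pose G3 : L0 := diota g3.
pose k := c' - 4%:R * A ^+ 2 * t.
pose l := - 2%:R * t * (c' + 4%:R * A ^+ 2 * t) + 4%:R * A ^+ 2 * t ^+ 2 + A ^+ 2 * G2.
pose m := (c' + 4%:R * A ^+ 2 * t) * t ^+ 2 - dder t ^+ 2 + A ^+ 2 * G3.
pose s := dder t ^+ 2 * A ^+ 2.
pose M := Poly [:: m ^+ 2 + 4%:R * s * G3; 2%:R * l * m + 4%:R * s * G2; l ^+ 2 + 2%:R * k * m;
   2%:R * k * l - 16%:R * s; k ^+ 2].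
(* The leading coefficient of [M] is k^2, and k = 0 would put t in C. *)
have k0 : k != 0.
  have A0 : A != 0 by rewrite fmorph_eq0.
  apply/eqP => kE; apply: (tnc (c / (4%:R * alpha ^+ 2))).
  rewrite rmorphM fmorphV rmorphM rmorphXn rmorph_nat -/A -/c'.
  have q0 : 4%:R * A ^+ 2 != 0 by rewrite mulf_neq0 ?expf_neq0 // (natrM _ 2 2) mulf_neq0.
  by apply: (mulIf q0); rewrite divfK // mulrC; apply/esym/eqP; rewrite -subr_eq0 -/k kE.
exists M.
  apply/eqP => /polyP/(_ 4); rewrite coef_Poly coef0 /= => /eqP.
  by rewrite sqrf_eq0 (negPf k0).
rewrite rootE map_Poly ?rmorph0 // horner_Poly /= -/t2.
rewrite /s /m /l /k /A /c' /G2 /G3.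
rewrite !(rmorph_nat, rmorphXn, rmorphM, rmorphB, rmorphN, rmorphD) /= !phi1C -/s1 -/t1 -/a.
(* The cubic terms in [t2] cancel, so [z] is k t2^2 + l t2 + m; by [rel] its value is 2 s1 s2. *)
pose z := (diota c + 4%:R * a ^+ 2 * (t1 + t2)) * (t1 - t2) ^+ 2 - s1 ^+ 2
  - a ^+ 2 * (4%:R * t2 ^+ 3 - diota g2 * t2 - diota g3).
have z2 : z ^+ 2 - 4%:R * s1 ^+ 2 * (a ^+ 2 * (4%:R * t2 ^+ 3 - diota g2 * t2 - diota g3)) = 0.
  by rewrite /z -S2 -rel; ring.
by apply/eqP; rewrite -[RHS]z2 /z; ring.
Qed.

End FirstIntegrals.

(** * Dependence outside the general type *)

Lemma deriv_eq0 (F : idomainType) (p : {poly F}) :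
  [pchar F] =i pred0 -> p^`() = 0 -> p = (p`_0)%:P.
Proof.
move=> /pcharf0P char0 /polyP p'0; apply/polyP=> -[|i]; rewrite coefC //=.
have /eqP := p'0 i; rewrite coef_deriv coef0 -mulr_natr mulf_eq0 char0 /=.
by rewrite orbF => /eqP.
Qed.

(* A root r of the quadratic turns the Riccati equation into a linear one for 1 / (t - r). *)
Lemma dder_riccati_inv (C : fieldType) (L : diffExt C) (t : L) (a2 a1 a0 r : C) :
  a2 * r ^+ 2 + a1 * r + a0 = 0 -> t - diota r != 0 ->
  dder t = diota a2 * t ^+ 2 + diota a1 * t + diota a0 ->
  dder (1 / (t - diota r)) =
    diota (- (2%:R * a2 * r + a1)) * (1 / (t - diota r)) + diota (- a2).
Proof.
move=> rE n0 tD; have := congr1 (@diota C L) rE.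
rewrite rmorph0 !(rmorphXn, rmorphM, rmorphD) /= => E.
rewrite dder_div // dderB dderC -{1}(rmorph1 (@diota C L)) dderC.
rewrite !(rmorph_nat, rmorphN, rmorphM, rmorphD) /=.
(* Subtracting the value 0 of the quadratic at [r] makes t' visibly divisible by t - r. *)
have -> : dder t = dder t - (diota a2 * diota r ^+ 2 + diota a1 * diota r + diota a0).
  by rewrite E subr0.
by rewrite tD; field.
Qed.

Section Coprime.
Variable C : fieldType.

Lemma fraction_coprimeP (f : {fraction {poly C}}) :
  exists a b, [/\ b != 0, coprimep a b & f = a%:F / b%:F].
Proof.
have [a [b [b0 ->]]] := fractionP f.
have g0 : gcdp a b != 0 by rewrite gcdp_eq0 negb_and b0 orbT.
have aE := divpK (dvdp_gcdl a b); have bE := divpK (dvdp_gcdr a b).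
have b'0 : b %/ gcdp a b != 0.
  by apply: contraNneq b0 => b'0; rewrite -bE b'0 mul0r.
exists (a %/ gcdp a b), (b %/ gcdp a b); split=> //.
  by rewrite coprimep_div_gcd // b0 orbT.
apply/eqP; rewrite eqr_div ?tofrac_eq0 // -!tofracM tofrac_eq.
by rewrite -{1}aE -[X in _ == _ * X]bE -mulrA [_ * (b %/ _)]mulrC.
Qed.

Variable h : {fraction {poly C}}.
Hypothesis (char0 : [pchar C] =i pred0) (h0 : h != 0).

(** For coprime a and b, the equation a' b = a b' forces b to divide b', which has smaller degree;
    hence b' = 0 and then a' = 0. *)
Lemma funfield_constants : constants_are_base (funfield h).
Proof.
move=> f; have [a [b [b0 cab ->]]] := fraction_coprimeP f.
rewrite /= ratder_frac // => /eqP; rewrite !mulf_eq0 (negPf h0) orbF.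
rewrite invr_eq0 !tofrac_eq0 expf_eq0 /= (negPf b0) orbF subr_eq0 => /eqP E.
have b'0 : b^`() = 0.
  apply/eqP; apply: contraTT isT => b'0.
  have : b %| b^`() by rewrite -(Gauss_dvdpr _ (q := a)) 1?coprimep_sym // -E dvdp_mull.
  by move/(dvdp_leq b'0); rewrite leqNgt lt_size_deriv.
have a'0 : a^`() = 0.
  by apply/eqP; move/eqP: E; rewrite b'0 mulr0 mulf_eq0 (negPf b0) orbF.
rewrite (deriv_eq0 char0 a'0) (deriv_eq0 char0 b'0).
by exists (a`_0 / b`_0); rewrite -[RHS]/(ratiota C _) rmorphM fmorphV.
Qed.

Lemma map_ratiota (p : {poly C}) : (map_poly (@diota C (funfield h)) p).['X%:F] = p%:F.
Proof.
elim/poly_ind: p => [|p c IHp]; first by rewrite !rmorph0 horner0.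
by rewrite !rmorphD !rmorphM /= map_polyX map_polyC !hornerE /= IHp.
Qed.

Lemma funfield_solution : solution h ('X%:F : funfield h).
Proof.
have [a [b [b0 hE]]] := fractionP h; exists a, b.
by rewrite !map_ratiota tofrac_eq0 -hE; split=> //; exact: ratder_y.
Qed.

Lemma funfield_nonalgebraic : has_nonalgebraic_solution h.
Proof.
exists (funfield h), ('X%:F : funfield h); split; first exact: funfield_constants.
  exact: funfield_solution.
by case=> p p0; rewrite rootE map_ratiota tofrac_eq0 (negPf p0).
Qed.

(** If finitely many elements spanned C(y) over C, then one more power of y than there are
    generators would satisfy a linear relation, read off the left kernel of the coefficient matrix.
    This serves to show that the t of each type is nonconstant. *)
Lemma not_finite_over_constants (s : seq (funfield h)) :
  (forall y, y \in s -> exists c, y = diota c) ->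
  ~ finite_over (adjoin (@diota C (funfield h)) s).
Proof.
move=> sC [b fin].
pose S (x : funfield h) := exists c : C, x = diota c.
have adjS x : adjoin diota s x -> S x.
  apply=> [|c|//]; last by exists c.
  split; first by exists 1; rewrite rmorph1.
  - by move=> _ _ [c ->] [d ->]; exists (c - d); rewrite rmorphB.
  - by move=> _ _ [c ->] [d ->]; exists (c / d); rewrite rmorphM fmorphV.
have coefs i : exists a : 'I_(size b) -> C,
    ('X^i)%:F = \sum_j (diota (a j) : funfield h) * b`_j.
  have [a aS ->] := fin (('X^i)%:F).
  have [c Ec] := fin_all_exists (fun j => adjS _ (aS j)).
  by exists c; apply: eq_bigr => j _; rewrite Ec.
have [a aE] := fin_all_exists (fun i : 'I_(size b).+1 => coefs i).
pose A := \matrix_(i < (size b).+1, j < size b) a i j.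
have : kermx A != 0.
  rewrite -mxrank_eq0 mxrank_ker -lt0n subn_gt0.
  exact: leq_ltn_trans (rank_leq_col A) (ltnSn _).
case/rowV0Pn=> v /sub_kermxP vA /negP[]; apply/eqP/rowP=> k; rewrite mxE.
have : \poly_(i < (size b).+1) v 0 (inord i) = 0.
  apply/eqP; rewrite -tofrac_eq0 poly_def rmorph_sum /=.
  rewrite (eq_bigr (fun i : 'I_ _ => \sum_j diota (v 0 i * a i j) * b`_j)).
    rewrite exchange_big big1 // => j _; rewrite -mulr_suml -rmorph_sum.
    have /rowP/(_ j) := vA; rewrite !mxE => vAj.
    rewrite (_ : \sum_i _ = 0) ?rmorph0 ?mul0r // -[RHS]vAj.
    by apply: eq_bigr => i _; rewrite ?mxE.
  move=> i _; rewrite inord_val -mul_polyC tofracM aE mulr_sumr.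
  by apply: eq_bigr => j _; rewrite rmorphM mulrA.
by move/polyP/(_ k); rewrite coef_poly ltn_ord coef0 inord_val.
Qed.

End Coprime.

Section DependentSolutions.
Variable C : closedFieldType.
Hypothesis char0 : [pchar C] =i pred0.
Variable h : {fraction {poly C}}.
Hypothesis h0 : h != 0.
Variables (L : diffExt C) (Lconst : constants_are_base L).
Variables (u v : L) (utr : transcendental u) (vtr : transcendental v).
Hypotheses (uh : solution h u) (vh : solution h v).

Let uD (f : funfield h) := fraceval_dder utr f uh.
Let vD (f : funfield h) := fraceval_dder vtr f vh.
Let uC (c : C) := fraceval_diota utr h c.
Let vC (c : C) := fraceval_diota vtr h c.

Lemma alg_dependent_fraceval (t : funfield h) : nonconstant t ->
  algebraicOver (fraceval utr) (fraceval vtr t) -> alg_dependent u v.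
Proof.
move=> tnc talg; apply: alg_dependent_algebraic.
exact: (algebraic_fraceval uC tnc talg).
Qed.

Lemma riccati_dependent : riccati_type h -> alg_dependent u v.
Proof.
case=> _ [t [a2 [a1 [a0 [fin tD _]]]]].
(* Were t in C, C(y) would be finite over C. *)
have tnc : nonconstant t.
  move=> c tE; apply: not_finite_over_constants fin => y.
  by rewrite inE => /eqP ->; exists c.
have [a20|a20] := eqVneq a2 0.
  apply: (alg_dependent_fraceval tnc).
  apply: (linear_algebraic Lconst uD vD uC vC (b := a1) (c := a0) tnc).
  by rewrite tD a20 rmorph0 mul0r add0r.
have [r rE] : exists r, a2 * r ^+ 2 + a1 * r + a0 = 0.
  have : size (Poly [:: a0; a1; a2]) != 1.
    by rewrite (PolyK (c := 0)).
  case/closed_rootP=> r; rewrite rootE horner_Poly /= => /eqP E.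
  by exists r; rewrite -[RHS]E; ring.
have n0 : t - diota r != 0 by rewrite subr_eq0; apply/eqP; exact: tnc.
pose s : funfield h := 1 / (t - diota r).
have snc : nonconstant s.
  move=> c sE; apply: (tnc (c^-1 + r)).
  by rewrite rmorphD fmorphV -sE /s div1r invrK subrK.
apply: (alg_dependent_fraceval snc).
apply: (linear_algebraic Lconst uD vD uC vC (b := - (2%:R * a2 * r + a1)) (c := - a2) snc).
exact: (dder_riccati_inv rE n0 tD).
Qed.

Lemma weierstrass_dependent : weierstrass_type h -> alg_dependent u v.
Proof.
case=> _ [t [g2 [g3 [alpha [fin tD _]]]]].
(* If t' = 0, both t and t' lie in C, against finiteness over C(t, t'). *)
have tD0 : dder t != 0.
  apply/eqP => tD0; have [c tE] := funfield_constants char0 h0 tD0.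
  apply: not_finite_over_constants fin => y.
  rewrite !inE => /orP[] /eqP ->; first by exists c.
  by exists 0; rewrite rmorph0.
have tnc : nonconstant t by move=> c tE; rewrite tE dderC eqxx in tD0.
have two0 : 2%:R != 0 :> C by move/pcharf0P: char0 => ->.
exact: alg_dependent_fraceval tnc
  (weierstrass_algebraic Lconst uD vD uC vC two0 tnc tD0 tD).
Qed.

End DependentSolutions.

Lemma alg_dependent_algebraicl (C : fieldType) (L : diffExt C) (u v : L) :
  algebraicOver diota u -> alg_dependent u v.
Proof.
case=> p p0 /rootP pu0; exists (p%:P); first by rewrite polyC_eq0.
by rewrite map_polyC /= hornerC pu0.
Qed.

Lemma alg_dependent_algebraicr (C : fieldType) (L : diffExt C) (u v : L) :
  algebraicOver diota v -> alg_dependent u v.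
Proof.
case=> p p0 /rootP pv0; exists (map_poly polyC p); first by rewrite map_poly_eq0.
have -> : map_poly (map_poly diota) (map_poly polyC p) =
    map_poly polyC (map_poly (@diota C L) p).
  by rewrite -!map_poly_comp; apply: eq_map_poly => c /=; rewrite map_polyC.
by rewrite horner_map pv0 /= hornerC.
Qed.

(** Two independent solutions are both transcendental, so their existence rules out each of the
    three special types in turn. *)
Lemma nongeneral_dependent (C : closedFieldType) (char0 : [pchar C] =i pred0)
    (h : {fraction {poly C}}) (h0 : h != 0) (L : diffExt C) :
  ~ general_type h -> constants_are_base L -> at_most_one_independent_solution h L.
Proof.
move=> ng Lconst u v uh vh _; apply: NNPP => indep; apply: ng.
have utr : transcendental u.
  by apply: nonalgebraic_transcendental => ualg; apply/indep/alg_dependent_algebraicl.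
have vtr : transcendental v.
  by apply: nonalgebraic_transcendental => valg; apply/indep/alg_dependent_algebraicr.
split; [|split] => ty; apply: indep.
- by apply: alg_dependent_algebraicl; exact: (ty L Lconst u uh).
- exact: (riccati_dependent Lconst utr vtr uh vh ty).
- exact: (weierstrass_dependent char0 h0 Lconst utr vtr uh vh ty).
Qed.

(** * Finiteness over C(t) *)

(** Over the closed field C a polynomial splits, and no factor t - z vanishes. *)
Lemma nonconstant_transcendental (C : closedFieldType) (L : diffExt C) (t : L) :
  nonconstant t -> transcendental t.
Proof.
move=> tnc p p0; have [r pE] := closed_field_poly_normal p.
rewrite pE -mul_polyC rmorphM rmorph_prod mulf_neq0 //.
  by rewrite /= map_polyC /horner_eval hornerC fmorph_eq0 lead_coef_eq0.
rewrite prodf_seq_neq0; apply/allP => z _ /=.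
rewrite rmorphB /= map_polyX map_polyC /horner_eval !hornerE subr_eq0.
exact/eqP/tnc.
Qed.

Lemma horner_map_modp (F E : fieldType) (phi : {rmorphism F -> E})
    (p q : {poly F}) (y : E) :
  root (map_poly phi p) y -> (map_poly phi (q %% p)).[y] = (map_poly phi q).[y].
Proof.
move=> /rootP py; rewrite [in RHS](divp_eq q p) rmorphD rmorphM /=.
by rewrite hornerD hornerM py mulr0 add0r.
Qed.

Section Adjoin.
Variables (C E : fieldType) (iota : {rmorphism C -> E}).

Lemma adjoin_is_subfield s : is_subfield (adjoin iota s).
Proof.
split; first by move=> S [].
- by move=> x y Sx Sy S SS SC Ss; case: (SS) => _ SB _; apply: SB; [exact: Sx|exact: Sy].
- by move=> x y Sx Sy S SS SC Ss; case: (SS) => _ _ SD; apply: SD; [exact: Sx|exact: Sy].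
Qed.

Lemma subfield_horner (S : E -> Prop) (p : {poly C}) x :
  is_subfield S -> (forall c, S (iota c)) -> S x -> S (map_poly iota p).[x].
Proof.
move=> [S1 SB SD] SC Sx.
have S0 : S 0 by rewrite -(subrr 1); apply: SB.
have SA y z : S y -> S z -> S (y + z).
  by move=> Sy Sz; rewrite -[z]opprK -[- z]sub0r; exact: (SB _ _ Sy (SB _ _ S0 Sz)).
have SM y z : S y -> S z -> S (y * z).
  by move=> Sy Sz; rewrite -[z]invrK -[z^-1]div1r; exact: (SD _ _ Sy (SD _ _ S1 Sz)).
elim/poly_ind: p => [|p c IHp]; first by rewrite rmorph0 horner0.
rewrite rmorphD rmorphM /= map_polyX map_polyC !hornerE.
by apply: SA; [apply: SM|apply: SC].
Qed.

End Adjoin.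

(** By [algebraic_fraceval], y is a root of a nonzero polynomial p over C(t); reducing modulo p
    shows that the powers of y below the degree of p span C(y). *)
Lemma finite_over_nonconstant (C : closedFieldType) (h : {fraction {poly C}})
  (t : funfield h) : [pchar C] =i pred0 -> h != 0 ->
  nonconstant t -> finite_over (adjoin diota [:: t]).
Proof.
move=> char0 h0 tnc; have ttr := nonconstant_transcendental tnc.
pose y : funfield h := 'X%:F; pose phi := fraceval ttr.
have phiC c : phi (ratiota C c) = diota c := fraceval_diota ttr h c.
have ytr : transcendental y.
  by move=> p; rewrite -tofrac_eq0 -(map_ratiota h).
have phiX : phi 'X%:F = t by rewrite /phi /= fracmap_tofrac /= map_polyX /horner_eval hornerX.
(* [algebraic_fraceval] speaks of t(v); for v = y this is t itself. *)
have ytE : fraceval ytr t = t.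
  have [a [b [b0 ->]]] := fractionP t.
  by rewrite fracevalE // !map_ratiota.
have [p p0 py] : algebraicOver phi y.
  apply: (algebraic_fraceval phiC (vtr := ytr) tnc).
  by rewrite ytE -phiX; exact: algebraic_id.
(* As y is algebraic over C(t), C(t)[y] is a field, so quotients are again polynomials in y. *)
have evalE (x : funfield h) : exists q, x = (map_poly phi q).[y].
  have polyE (a : {poly C}) : a%:F = subfx_inj (subfx_eval phi y p (map_poly (ratiota C) a)).
    rewrite subfx_inj_eval // -map_poly_comp -(map_ratiota h); congr _.[_].
    by apply: eq_map_poly => c; rewrite [RHS]phiC.
  have [a [b [b0 ->]]] := fractionP x.
  rewrite !polyE -fmorph_div /=. set w := (X in subfx_inj X); have [q ->] := subfxE w.
  by exists q; rewrite subfx_inj_eval.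
pose n := (size p).-1.
exists (mkseq (fun i => y ^+ i) n) => x.
have [q ->] := evalE x.
have szq : (size (q %% p)%R <= n)%N by rewrite -ltnS prednK ?ltn_modp ?size_poly_gt0.
exists (fun i => phi (q %% p)`_i).
  move=> i; have [a [b [b0 ->]]] := fractionP (q %% p)`_i.
  have adj := adjoin_is_subfield (@diota C (funfield h)) [:: t].
  have [_ _ adjD] := adj.
  have adjC c : adjoin (@diota C (funfield h)) [:: t] (diota c) by move=> S _ SC _.
  have adjt : adjoin (@diota C (funfield h)) [:: t] t.
    by move=> S _ _ St; apply: St; rewrite inE.
  have adj_horner := subfield_horner _ adj adjC adjt.
  by rewrite fracevalE //; exact: (adjD _ _ (adj_horner a) (adj_horner b)).
rewrite -(horner_map_modp q py).
rewrite (@horner_coef_wide _ n) ?size_map_poly // size_mkseq.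
by apply: eq_bigr => i _; rewrite coef_map nth_mkseq.
Qed.

(** Finiteness over C(t) is automatic for nonconstant t, so a linear equation suffices; its
    coefficients cannot both vanish, since t' = 0 would put t in C. *)
Lemma riccati_nonconstant (C : closedFieldType) (h : {fraction {poly C}})
    (t : funfield h) (a1 a0 : C) :
  [pchar C] =i pred0 -> h != 0 ->
  nonconstant t -> dder t = diota a1 * t + diota a0 -> riccati_type h.
Proof.
move=> char0 h0 tnc tD; split; first exact: funfield_nonalgebraic.
exists t, 0, a1, a0; split.
- exact: finite_over_nonconstant.
- by rewrite rmorph0 mul0r add0r.
- case=> _ a10 a00; move: tD; rewrite a10 a00 !rmorph0 mul0r addr0.
  by move/(funfield_constants char0 h0) => [c /tnc].
Qed.

(** * The derivation on K(w) *)

Section SimpleExtension.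
Variables (C : fieldType) (K : diffExt C).
Implicit Types (P Q A B G : {poly K}).

Definition coefder P : {poly K} := map_poly dder P.

Lemma coef_coefder P i : (coefder P)`_i = dder P`_i.
Proof. by rewrite coef_map_id0 // dder0. Qed.

Lemma coefderD P Q : coefder (P + Q) = coefder P + coefder Q.
Proof. by apply/polyP => i; rewrite !(coef_coefder, coefD) dderD. Qed.

Lemma dder_sum I (r : seq I) (F : I -> K) :
  dder (\sum_(i <- r) F i) = \sum_(i <- r) dder (F i).
Proof. by elim/big_rec2: _ => [|i x y _ <-]; rewrite ?dder0 ?dderD. Qed.

Lemma coefderM P Q : coefder (P * Q) = coefder P * Q + P * coefder Q.
Proof.
apply/polyP => i; rewrite coefD coef_coefder !coefM dder_sum -big_split.
by apply: eq_bigr => j _; rewrite dderM !coef_coefder.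
Qed.

Lemma coefderC (x : K) : coefder x%:P = (dder x)%:P.
Proof.
by apply/polyP => -[|i]; rewrite coef_coefder !coefC // dder0.
Qed.

Lemma coefderXn n : coefder 'X^n = 0.
Proof.
apply/polyP => i; rewrite coef_coefder coefXn coef0.
by rewrite -(rmorph_nat (@diota C K)) dderC.
Qed.

Variable H : {fraction {poly K}}.

Definition polyder P : {fraction {poly K}} := (coefder P)%:F + (P^`())%:F * H.

Lemma polyderD P Q : polyder (P + Q) = polyder P + polyder Q.
Proof.
rewrite /polyder coefderD derivD !tofracD mulrDl; exact: addrACA.
Qed.

Lemma polyderM P Q : polyder (P * Q) = polyder P * Q%:F + P%:F * polyder Q.
Proof.
rewrite /polyder coefderM derivM !(tofracD, tofracM) !(mulrDl, mulrDr).
rewrite -!addrA; congr (_ + _); rewrite addrCA; congr (_ + _).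
  exact: mulrAC.
by congr (_ + _); rewrite mulrA.
Qed.

Definition simpleext_iota : {rmorphism C -> {fraction {poly K}}} :=
  (@tofrac {poly K}) \o (polyC \o diota).

Lemma polyderC (x : K) : polyder x%:P = (dder x)%:P%:F.
Proof. by rewrite /polyder coefderC derivC tofrac0 mul0r addr0. Qed.

Lemma simpleext_dderC c : fracder polyder (simpleext_iota c) = 0.
Proof. by rewrite /= (fracder_tofrac polyderM) polyderC dderC tofrac0. Qed.

(* The field K(w) with the derivation extending that of K with w' = H. *)
Definition simpleext : diffExt C :=
  DiffExt (fracderD polyderD polyderM) (fracderM polyderM) simpleext_dderC.

Lemma simpleext_dder_tofrac P : dder (P%:F : simpleext) = polyder P.
Proof. exact: (fracder_tofrac polyderM). Qed.

Lemma simpleext_dder_gen : dder ('X%:F : simpleext) = H.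
Proof.
rewrite simpleext_dder_tofrac /polyder -['X]expr1 coefderXn expr1 derivX.
by rewrite tofrac0 add0r tofrac1 mul1r.
Qed.

End SimpleExtension.

Lemma factorX (R : idomainType) (P : {poly R}) :
  P != 0 -> exists (A : {poly R}) i, A`_0 != 0 /\ P = A * 'X^i.
Proof.
move=> P0; have [i [A]] := multiplicity_XsubC P 0.
by rewrite P0 /= rootE horner_coef0 subr0 => A0 PE; exists A, i.
Qed.

Lemma coprimepXn (F : fieldType) (B : {poly F}) k : B`_0 != 0 -> coprimep B 'X^k.
Proof.
move=> B0; case: k => [|k]; first by rewrite expr0 coprimep1.
by rewrite coprimep_pexpr // -['X]subr0 coprimep_XsubC rootE horner_coef0.
Qed.

(** * Constants of K(w) when w' vanishes at w = 0 *)

Section ZeroOfVectorField.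
Variables (C : fieldType) (K : diffExt C).
Variables (n : nat) (r q : {poly C}).
Hypotheses (r0 : r`_0 != 0) (q0 : q`_0 != 0).
Local Notation rK := (map_poly (@diota C K) r).
Local Notation qK := (map_poly (@diota C K) q).
Local Notation H := (('X^(n.+1) * rK)%:F / qK%:F).
Local Notation L := (simpleext H).
Implicit Types (P Q A B G : {poly K}).

Let qK0 : qK != 0.
Proof. by rewrite map_poly_eq0; apply: contraNneq q0 => ->; rewrite coef0. Qed.

(** The derivation of K(w) multiplied by [qK], which maps K[w] to itself. *)
Let hatder P : {poly K} := qK * coefder P + 'X^(n.+1) * rK * P^`().

Let polyder_hat P : polyder H P = (hatder P)%:F / qK%:F.
Proof.
rewrite /polyder /hatder tofracD mulrDl; congr (_ + _).
  by rewrite tofracM mulrC mulKf ?tofrac_eq0.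
by rewrite mulrA -tofracM [P^`() * _]mulrC.
Qed.

Let hatderM P Q : hatder (P * Q) = hatder P * Q + P * hatder Q.
Proof. by rewrite /hatder coefderM derivM; ring. Qed.

Let hatderD P Q : hatder (P + Q) = hatder P + hatder Q.
Proof. by rewrite /hatder coefderD derivD; ring. Qed.

Let hatderXn i : hatder 'X^i = 'X^n * rK * i%:R * 'X^i.
Proof.
rewrite /hatder coefderXn mulr0 add0r derivXn.
case: i => [|i]; first by rewrite mulr0n !mulr0 mul0r.
by rewrite /= -mulr_natr !exprS; ring.
Qed.

(* G is the power series expansion of A / B, truncated after order n. *)
Lemma constant_expansion A B i j : A`_0 != 0 -> B`_0 != 0 ->
  dder ((A * 'X^i)%:F / (B * 'X^j)%:F : L) = 0 ->
  exists G, [/\ G`_0 = A`_0 / B`_0, forall k, (k < n)%N -> dder G`_k = 0 &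
    dder G`_n = diota ((j%:R - i%:R) * (r`_0 / q`_0)) * G`_0].
Proof.
move=> A0 B0; have nz P : P`_0 != 0 -> P != 0.
  by move=> P0; apply: contraNneq P0 => ->; rewrite coef0.
have Xn0 k : 'X^k != 0 :> {poly K} by rewrite expf_neq0 ?polyX_eq0.
have BX0 : B * 'X^j != 0 := mulf_neq0 (nz B B0) (Xn0 j).
rewrite dder_div ?tofrac_eq0 // !simpleext_dder_tofrac !polyder_hat.
move/eqP; rewrite mulf_eq0 invr_eq0 expf_eq0 /= tofrac_eq0 (negPf BX0) orbF.
rewrite mulrA [_ / _ * _]mulrAC -mulrBl mulf_eq0 invr_eq0 tofrac_eq0 (negPf qK0) orbF.
rewrite -!tofracM -tofracB tofrac_eq0 !hatderM !hatderXn => /eqP E.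
(* As B is prime to w, it is invertible modulo w^(n+1); this gives the truncated quotient [G] and a
   remainder w^(n+1) S. *)
have [[u w] /= uw] := Bezout_eq1_coprimepP _ _ (coprimepXn n.+1 B0).
have [G [S AE]] : exists G S, A = B * G + 'X^(n.+1) * S.
  by exists (A * u), (A * w); rewrite -[LHS]mulr1 -uw; ring.
(* [W] gathers the contributions of S; they all carry w^(n+1), because the derivation preserves
   divisibility by powers of w. *)
pose W := hatder S * B + n.+1%:R * 'X^n * rK * S * B - S * hatder B
  + (i%:R - j%:R) * 'X^n * rK * S * B.
have {}E : B ^+ 2 * (hatder G + (i%:R - j%:R) * 'X^n * rK * G) = - W * 'X^(n.+1).
  have EA : hatder A * B - A * hatder B + (i%:R - j%:R) * 'X^n * rK * A * B = 0.
    apply: (mulIf (mulf_neq0 (Xn0 i) (Xn0 j))); rewrite mul0r -[RHS]E; ring.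
  apply/eqP; rewrite -subr_eq0 -[X in _ == X]EA AE hatderD !hatderM hatderXn /W.
  by apply/eqP; ring.
have {E} : 'X^(n.+1) %| hatder G + (i%:R - j%:R) * 'X^n * rK * G.
  rewrite -(@Gauss_dvdpr _ _ (B ^+ 2)) ?E ?dvdp_mull //.
  by rewrite coprimep_sym coprimep_expl // coprimepXn.
have -> : hatder G + (i%:R - j%:R) * 'X^n * rK * G =
    (qK * coefder G + (i%:R - j%:R) * 'X^n * rK * G) + rK * G^`() * 'X^(n.+1).
  by rewrite /hatder; ring.
rewrite dvdp_addl ?dvdp_mull // => dvd1.
(* The other term is divisible by w^n and q is prime to w, so the coefficients of [G] below degree n
   are constants. *)
have : 'X^n %| coefder G.
  rewrite -(@Gauss_dvdpr _ _ qK); last first.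
    by rewrite coprimep_sym coprimepXn // coef_map fmorph_eq0.
  rewrite -(@dvdp_addl _ ((i%:R - j%:R) * rK * G * 'X^n)) ?dvdp_mull //.
  apply: dvdp_trans (dvdp_exp2l 'X (leqnSn n)) _.
  by move: dvd1; congr (_ %| _); ring.
case/dvdpP => T TE.
(* After division by w^n, the value at w = 0 yields the derivative of the coefficient of degree
   n. *)
have : 'X %| qK * T + (i%:R - j%:R) * rK * G.
  rewrite -(@dvdp_mul2r _ 'X^n) // -exprS; move: dvd1; congr (_ %| _).
  by rewrite TE; ring.
rewrite -['X]subr0 dvdp_XsubCl rootE horner_coef0 => /eqP T0.
exists G; split.
- have := congr1 (fun P : {poly K} => P`_0) AE.
  rewrite coefD !coef0M coefXn /= mul0r addr0 => ->.
  by rewrite [RHS]mulrC mulKf.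
- by move=> k kn; rewrite -coef_coefder TE coefMXn kn.
- rewrite -coef_coefder TE coefMXn ltnn subnn.
  have kE : i%:R - j%:R = (i%:R - j%:R)%:P :> {poly K} by rewrite rmorphB !rmorph_nat.
  move: T0; rewrite kE coefD !coef0M coefC !coef_map /=.
  have qL0 : diota q`_0 != 0 :> K by rewrite fmorph_eq0.
  move=> T0; apply: (mulfI qL0); rewrite !(rmorphM, rmorphB, fmorphV, rmorph_nat) /=.
  have -> : diota q`_0 * T`_0 = diota q`_0 * T`_0 - 0 by rewrite subr0.
  by rewrite -[X in _ - X]T0; field.
Qed.

Hypothesis char0 : [pchar C] =i pred0.
Hypothesis Kconst : constants_are_base K.
Hypothesis nolinear : forall (t : K) (a1 a0 : C), nonconstant t ->
  dder t = diota a1 * t + diota a0 -> False.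

(** A constant has neither zero nor pole at w = 0. Otherwise G_n' = e G_0 with e nonzero: for n = 0
    this is a linear equation for G_0, and for n > 0 G_0 lies in C and G_n has a nonzero derivative
    in C. Both contradict [nolinear]. *)
Lemma constant_order A B i j : A`_0 != 0 -> B`_0 != 0 ->
  dder ((A * 'X^i)%:F / (B * 'X^j)%:F : L) = 0 -> i = j.
Proof.
move=> A0 B0 /(constant_expansion A0 B0) [G [G0 Glt Gn]].
apply/eqP/negPn/negP => ij.
set e := _ * (_ / _) in Gn.
have e0 : e != 0.
  rewrite !mulf_neq0 ?invr_eq0 //; move/pcharf0P: char0 => ch.
  (* Up to sign j - i is a positive integer, which is nonzero in characteristic zero. *)
  wlog lij : i j ij {Gn e} / (i < j)%N.
    move=> IH; case: (ltngtP i j) ij => // lij _.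
      by apply: IH => //; rewrite ltn_eqF.
    by rewrite -opprB oppr_eq0 IH // ltn_eqF.
  by rewrite -natrB ?(ltnW lij) // ch -lt0n subn_gt0.
have G00 : G`_0 != 0 by rewrite G0 mulf_neq0 ?invr_eq0.
have [n0|npos] := posnP n.
  apply: (nolinear (t := G`_0) (a1 := e) (a0 := 0)); last first.
    by rewrite rmorph0 addr0 -Gn n0.
  move=> c cE; move/eqP: Gn; rewrite n0 {1}cE dderC eq_sym mulf_eq0.
  by rewrite (negPf G00) fmorph_eq0 (negPf e0).
have [c cE] := Kconst (Glt 0 npos).
apply: (nolinear (t := G`_n) (a1 := 0) (a0 := e * c)); last first.
  by rewrite rmorph0 mul0r add0r Gn cE -rmorphM.
move=> b bE; move/eqP: Gn; rewrite bE dderC eq_sym mulf_eq0.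
by rewrite (negPf G00) fmorph_eq0 (negPf e0).
Qed.

(** The value c of a constant f at w = 0 lies in C. If f - c were nonzero, it would be a constant
    vanishing at w = 0, against [constant_order]. *)
Lemma simpleext_constants : constants_are_base L.
Proof.
move=> f; have [P [Q [Q0 ->]]] := fractionP f.
have [->|P0] := eqVneq P 0; first by exists 0; rewrite tofrac0 mul0r rmorph0.
have [A [i [A0 PE]]] := factorX P0; have [B [j [B0 QE]]] := factorX Q0.
rewrite PE QE => D0; have ij := constant_order A0 B0 D0; rewrite -ij {j ij QE PE} in D0 *.
have [G [G0 Glt Gn]] := constant_expansion A0 B0 D0.
have [c cE] : exists c : C, G`_0 = diota c.
  apply: Kconst; case: (posnP n) => [n0|]; last exact: Glt.
  (* For n = 0 the last clause of the expansion applies, with equal exponents. *)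
  by rewrite -[X in G`_X]n0 Gn subrr mul0r rmorph0 mul0r.
have Bn0 : B != 0 by apply: contraNneq B0 => ->; rewrite coef0.
have Xi0 : 'X^i != 0 :> {poly K} by rewrite expf_neq0 ?polyX_eq0.
have cancel : (A * 'X^i)%:F / (B * 'X^i)%:F = A%:F / B%:F :> {fraction {poly K}}.
  by rewrite !tofracM -mulf_div divff ?tofrac_eq0 // mulr1.
rewrite cancel in D0 *; exists c.
pose N := A - (diota c)%:P * B.
have NE : (A%:F / B%:F : L) - diota c = N%:F / B%:F.
  suff : A%:F / B%:F - (diota c)%:P%:F = N%:F / B%:F :> {fraction {poly K}} by [].
  by rewrite tofracB mulrBl tofracM mulfK ?tofrac_eq0.
apply/eqP; rewrite -subr_eq0 NE; apply/negPn/negP => N0.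
have {}N0 : N != 0 by apply: contraNneq N0 => ->; rewrite tofrac0 mul0r.
have ND : dder (N%:F / B%:F : L) = 0 by rewrite -NE dderB D0 dderC subrr.
have [A' [i' [A'0 N'E]]] := factorX N0.
have i'0 : i' = 0%N.
  apply: (constant_order A'0 B0); rewrite -N'E expr0 mulr1; exact: ND.
have : N`_0 != 0 by rewrite N'E i'0 expr0 mulr1.
by rewrite /N coefB coefCM -cE G0 divfK // subrr eqxx.
Qed.

End ZeroOfVectorField.

(** * Two independent solutions *)

Lemma antiderivative (F : fieldType) (p : {poly F}) :
  [pchar F] =i pred0 -> exists P : {poly F}, P^`() = p.
Proof.
(* At i = 0 the coefficient is p_0 / 0, which is 0. *)
move=> /pcharf0P char0; exists (\poly_(i < (size p).+1) (p`_i.-1 / i%:R)).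
apply/polyP => i; rewrite coef_deriv coef_poly ltnS /=.
case: ltnP => [_|ip]; last by rewrite mul0rn nth_default.
by rewrite -[LHS]mulr_natr divfK // char0.
Qed.

(** If dP/dy = 1 / h, the chain rule gives P the derivative 1 in C(y). *)
Lemma riccati_inverse_polynomial (C : closedFieldType) (h : {fraction {poly C}})
    (q : {poly C}) :
  [pchar C] =i pred0 -> h != 0 -> h^-1 = q%:F -> riccati_type h.
Proof.
move=> char0 h0 hq; have [P PE] := antiderivative q char0.
have PD : dder (P%:F : funfield h) = 1.
  rewrite -[P%:F]divr1 -tofrac1 /= ratder_frac ?oner_neq0 //.
  by rewrite derivC mulr0 subr0 mulr1 PE expr1n tofrac1 divr1 -hq mulVf.
apply: (riccati_nonconstant (t := P%:F : funfield h) (a1 := 0) (a0 := 1)) => //.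
  move=> c cE; have : dder (P%:F : funfield h) = 0 by rewrite cE dderC.
  by rewrite PD => /eqP; rewrite oner_eq0.
by rewrite PD rmorph0 mul0r add0r rmorph1.
Qed.

Lemma horner_diota_morph (C : fieldType) (L0 L : diffExt C)
    (phi : {rmorphism L0 -> L}) (p : {poly C}) (u : L0) :
  (forall c, phi (diota c) = diota c) ->
  (map_poly diota p).[phi u] = phi (map_poly diota p).[u].
Proof.
move=> phiC; rewrite -horner_map -map_poly_comp; congr _.[_].
by apply: eq_map_poly => c /=.
Qed.

Lemma solution_morph (C : fieldType) (h : {fraction {poly C}}) (L0 L : diffExt C)
    (phi : {rmorphism L0 -> L}) (u : L0) :
  (forall x, dder (phi x) = phi (dder x)) -> (forall c, phi (diota c) = diota c) ->
  solution h u -> solution h (phi u).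
Proof.
move=> phiD phiC [p [q [hE q0 uD]]].
exists p, q; rewrite !(horner_diota_morph _ _ phiC) fmorph_eq0 phiD uD; split=> //.
by rewrite rmorphM fmorphV.
Qed.

Section TwoSolutions.
Variables (C : closedFieldType) (h : {fraction {poly C}}).
Local Notation K := (funfield h).
Variables (p q : {poly C}) (a : C) (H : {fraction {poly K}}).
Hypotheses (q0 : q != 0) (hE : h = p%:F / q%:F).
Local Notation shift s := (s \Po ('X + a%:P)).
Hypothesis HE : H = (map_poly diota (shift p))%:F / (map_poly diota (shift q))%:F.
Local Notation L := (simpleext H).

Let u : L := (('X%:F : K)%:P)%:F.
(** The generator w is v - a, which moves the point a to the origin; accordingly [H] is h(w + a). *)
Let v : L := ('X + (diota a : K)%:P)%:F.
Let const_emb : {rmorphism K -> L} := (@tofrac {poly K}) \o polyC.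

Let horner_v (s : {poly C}) :
  (map_poly (@diota C L) s).[v] = (map_poly (@diota C K) (shift s))%:F.
Proof.
have -> : map_poly (@diota C L) s = map_poly const_emb (map_poly (@diota C K) s).
  by rewrite -map_poly_comp; apply: eq_map_poly.
rewrite map_comp_poly /comp_poly /= rmorphD /= map_polyX map_polyC /=.
rewrite -[RHS]/(tofrac _) -horner_map; congr _.[_].
exact: (map_poly_comp (@tofrac {poly K}) polyC).
Qed.

Lemma first_solution : solution h u.
Proof.
apply: (solution_morph (phi := const_emb) _ _ (funfield_solution h)) => //.
by move=> x; rewrite [LHS](simpleext_dder_tofrac H x%:P) polyderC.
Qed.

Lemma second_solution : solution h v.
Proof.
have vq : (map_poly (@diota C L) q).[v] != 0.
  by rewrite horner_v tofrac_eq0 map_poly_eq0 comp_poly2_eq0 ?size_XaddC.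
exists p, q; split; [exact: hE|exact: vq|].
have vD : dder v = H.
  rewrite simpleext_dder_tofrac polyderD polyderC dderC tofrac0 addr0.
  by rewrite -simpleext_dder_tofrac simpleext_dder_gen.
by rewrite vD HE -(horner_v p) -(horner_v q).
Qed.

Lemma solutions_neq : u <> v.
Proof.
move/eqP; rewrite tofrac_eq => /eqP/(congr1 (fun P : {poly K} => size P)).
by rewrite size_XaddC => E; have := size_polyC_leq1 ('X%:F : K); rewrite E.
Qed.

(** A relation is a polynomial over C[y] that vanishes at w + a; substituting w + a, of degree one
    in w, kills no nonzero polynomial over K. *)
Lemma solutions_independent : ~ alg_dependent u v.
Proof.
case=> P P0; rewrite horner2_polyeval.
have E s : polyeval u s = const_emb s%:F.
  have := @horner_diota_morph C K L const_emb s ('X%:F : K) (fun=> erefl).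
  by rewrite (map_ratiota h); exact.
have {}E : map_poly (polyeval u) P = map_poly const_emb (map_poly (@tofrac _) P).
  by rewrite -map_poly_comp; apply: eq_map_poly => s; rewrite E.
rewrite E map_poly_comp horner_map => /eqP; rewrite tofrac_eq0.
rewrite -/(comp_poly _ _) comp_poly2_eq0 ?size_XaddC // => /eqP P'0.
move/eqP: P0; apply; apply/polyP => i; apply/eqP.
move/polyP/(_ i): P'0; rewrite coef_map !coef0 /= => /eqP.
by rewrite tofrac_eq0.
Qed.

End TwoSolutions.

Lemma dependent_nongeneral (C : closedFieldType) (h : {fraction {poly C}}) :
  [pchar C] =i pred0 -> h != 0 ->
  (forall L : diffExt C, constants_are_base L ->
     at_most_one_independent_solution h L) -> ~ general_type h.
Proof.
move=> char0 h0 dep [_ [nric _]].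
have [p [q [q0 cpq hE]]] := fraction_coprimeP h.
have p0 : p != 0 by apply: contraNneq h0 => p0; rewrite hE p0 tofrac0 mul0r.
(* A constant numerator makes 1 / h a polynomial; otherwise the numerator has a root a, and by
   coprimality a is a zero of h. *)
have [/eqP/size_poly1P [c c0 pE]|/closed_rootP [a pa]] := eqVneq (size p) 1%N.
  apply: nric; apply: (riccati_inverse_polynomial (q := c^-1 *: q)) => //.
  have cF0 : c%:P%:F != 0 :> {fraction {poly C}} by rewrite tofrac_eq0 polyC_eq0.
  rewrite hE pE invf_div -mul_polyC tofracM mulrC; congr (_ * _).
  by apply: (mulIf cF0); rewrite mulVf // -tofracM -polyCM mulVf // tofrac1.
have szX : size ('X + a%:P) = 2 by rewrite size_XaddC.
have qa : (q \Po ('X + a%:P))`_0 != 0.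
  rewrite -horner_coef0 horner_comp !hornerE.
  by exact: coprimep_root cpq pa.
have p'0 : p \Po ('X + a%:P) != 0 by rewrite comp_poly2_eq0.
(* The order of the zero is written n + 1; order 0 is excluded by p(a) = 0. *)
have [r [[|n] [r0 rE]]] := factorX p'0.
  move: r0; have -> : r = p \Po ('X + a%:P) by rewrite rE expr0 mulr1.
  by rewrite -horner_coef0 horner_comp !hornerE (rootP pa) eqxx.
pose H : {fraction {poly funfield h}} := ('X^(n.+1) * map_poly diota r)%:F
  / (map_poly diota (q \Po ('X + a%:P)))%:F.
have HE : H = (map_poly diota (p \Po ('X + a%:P)))%:F
  / (map_poly diota (q \Po ('X + a%:P)))%:F.
  by rewrite /H rE (rmorphM (map_poly diota)) /= map_polyXn [_ * 'X^_]mulrC.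
(* A nonconstant element of C(y) satisfying a linear equation would make h of Riccati type, which
   [nric] excludes. *)
have Lconst : constants_are_base (simpleext H).
  apply: simpleext_constants => //; first exact: funfield_constants.
  by move=> t a1 a0 tnc tD; apply: nric; exact: riccati_nonconstant tnc tD.
apply: (solutions_independent (H := H) (a := a)).
apply: (dep _ Lconst).
- exact: first_solution.
- exact: (second_solution q0 hE HE).
- exact: solutions_neq.
Qed.

Theorem mainTheorem7 (C : closedFieldType) (char0 : [pchar C] =i pred0)
    (h : {fraction {poly C}}) (h_neq0 : h != 0) :
  ~ general_type h <->
  (forall L : diffExt C, constants_are_base L ->
     at_most_one_independent_solution h L).
Proof.
split=> [ng L Lconst|]; last exact: dependent_nongeneral.
exact: nongeneral_dependent.
Qed.
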